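(* For each $i \geq 2$ and $0 \leq j \leq i-1$, let $A_{i,j}$ and $B_{i,j}$ denote the set of the starting positions of the occurrences of $T_{i-j}$ and $\overline{T_{i-j}}$ in $T_i$, respectively. Then $A_{i,0} = A_{i,1} = \{1\}$. For each $j \geq 2$, define \begin{align*} B_{i,j-1}' &:= B_{i,j-1} \oplus \tau_{i-j}, \qquad A_{i,j-2}' := A_{i,j-2} \oplus \left(\tau_{i-j} + \tau_{i-(j+1)}\right), \\ I_{i,j-3} &:= \begin{cases} \emptyset, & j = 2, \\ A_{i, j-3}' \cup B_{i, j-3}', & j \geq 3, \text{ where} \end{cases} \\ A_{i, j-3}' &:= A_{i,j-3} \oplus (\tau_{i-(j-1)} + \tau_{i-j}), \qquad B_{i, j-3}' := B_{i,j-3} \oplus \tau_{i-(j-2)}. \end{align*} Then $A_{i,j} = A_{i,j-1} \cup B_{i,j-1}' \cup A_{i,j-2}'$ with \[ A_{i,j-1} \cap B_{i,j-1}' = I_{i,j-3}, \quad A_{i,j-1} \cap A_{i,j-2}' = \emptyset, \quad \text{and} \quad B_{i,j-1}' \cap A_{i,j-2}' = \emptyset. \]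
   Context: Strings are over $\{\texttt{a},\texttt{b}\}$. For a binary string $S$, $\overline{S}$ is obtained by swapping \texttt{a} and \texttt{b}. The Thue-Morse word is $T_1 := \texttt{a}$, $T_i := T_{i-1}\overline{T_{i-1}}$ for $i\ge 2$, and $\tau_i := |T_i| = 2^{i-1}$. For a set of integers $A$ and an integer $i$, $A \oplus i := \{a+i : a \in A\}$.
   Formalization: For j = i-1 the shift defining A'_{i,j-2} involves the undefined τ_0, and the claim fails for every value of it (e.g. i = 3, j = 2); in this case the formal statement takes A'_{i,j-2} to be empty. *)

(* Defs.v *)
From mathcomp Require Import all_boot.
From mathcomp Require Import classical_sets.

Set Implicit Arguments.
Unset Strict Implicit.
Unset Printing Implicit Defensive.

Local Open Scope classical_set_scope.

(* The letter a is [false] and the letter b is [true]. *)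
Notation letter_a := false (only parsing).

Definition word := seq bool.

Definition overline (S : word) : word := map negb S.

(* Thue-Morse words are indexed from 1; T 0 is a dummy value. *)
Fixpoint T (i : nat) : word :=
  match i with
  | 0 => [::]
  | 1 => [:: letter_a]
  | k.+1 => T k ++ overline (T k)
  end.

Definition tau (i : nat) : nat := size (T i).

Lemma tauE (i : nat) : 1 <= i -> tau i = 2 ^ i.-1.
Proof.
case: i => // i _; elim: i => [//|i IHi].
have -> : tau i.+2 = tau i.+1 + tau i.+1.
  by rewrite /tau -[T i.+2]/(T i.+1 ++ overline (T i.+1)) size_cat size_map.
by rewrite IHi /= addnn -mul2n -expnS.
Qed.

(* Positions in a word are counted from 1. *)
Definition occ (P S : word) : set nat :=
  [set p | exists u v : word, S = u ++ P ++ v /\ p = (size u).+1].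

Definition oplus (A : set nat) (s : nat) : set nat := [set a + s | a in A].

Definition A (i j : nat) : set nat := occ (T (i - j)) (T i).
Definition B (i j : nat) : set nat := occ (overline (T (i - j))) (T i).

(* In the names below, "_m k" refers to the subscript j - k: for instance
   A'_m2 i j is the set A'_{i,j-2} and A'_m3 i j is the set A'_{i,j-3}.  All
   of them are meant for 2 <= j <= i - 1, and the "_m3" ones for 3 <= j, so
   that no subtraction is truncated. *)
Definition B'_m1 (i j : nat) : set nat := oplus (B i (j - 1)) (tau (i - j)).

(* The shift tau_{i-j} + tau_{i-(j+1)} involves tau_0 when j = i - 1, whereas
   the words T_k start at k = 1.  In this boundary case the set is empty: it
   collects the occurrences of T_k, with k = i - j, that start in the middle of
   a factor overline(T_k) overline(T_k), i.e. tau_{k-1} = 2 ^ (k - 2) letters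
   after its beginning, and for k = 1 that factor is bb, which has no a. *)
Definition A'_m2 (i j : nat) : set nat :=
  if j + 1 < i then oplus (A i (j - 2)) (tau (i - j) + tau (i - (j + 1)))
  else set0.

Definition A'_m3 (i j : nat) : set nat :=
  oplus (A i (j - 3)) (tau (i - (j - 1)) + tau (i - j)).

Definition B'_m3 (i j : nat) : set nat :=
  oplus (B i (j - 3)) (tau (i - (j - 2))).

Definition I_m3 (i j : nat) : set nat :=
  if j == 2 then set0 else A'_m3 i j `|` B'_m3 i j.

(* Main.v *)
(** Let t be the infinite Thue-Morse word, the fixed point of the morphism
    a -> ab, b -> ba, and count positions from 0.  A word T_k with k >= 3
    starts with abba, whose factor bb cannot sit inside an image of a letter;
    hence T_k occurs in t only at even positions 2q, and then T_(k-1) occurs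
    at q.  Iterating, the occurrences of T_(k+2) are the positions 2^k r such
    that ab occurs at r.  All claims thus become statements about the factors
    a, ab and ba of t.  What remains is to locate the factors aa and bb: these
    start at odd positions 2s+1, inside the images of ba and ab. *)
Require Import Defs.
From mathcomp Require Import all_boot.
From mathcomp Require Import classical_sets.
From mathcomp Require Import zify.

Local Open Scope classical_set_scope.

(** * The morphism and its infinite fixed point *)

Definition morse (s : word) : word := flatten [seq [:: b; ~~ b] | b <- s].

Lemma morse_overline (s : word) : morse (overline s) = overline (morse s).
Proof. by elim: s => //= b s; rewrite /morse /= => ->. Qed.

Lemma TS (i : nat) : T i.+2 = T i.+1 ++ overline (T i.+1).
Proof. by []. Qed.

Lemma T_morse (i : nat) : T i.+2 = morse (T i.+1).
Proof.
elim: i => // i IHi.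
by rewrite [in LHS]TS [in RHS]TS IHi -morse_overline /morse map_cat flatten_cat.
Qed.

Lemma nth_morse (s : word) (p : nat) : p < size s ->
  nth false (morse s) p.*2 = nth false s p /\
  nth false (morse s) p.*2.+1 = ~~ nth false s p.
Proof. by elim: s p => // b s IHs [|p] //= /IHs. Qed.

Lemma size_T (i : nat) : size (T i.+1) = 2 ^ i.
Proof. exact: (@tauE i.+1). Qed.

(** The letter of t at position p: [T p.+1] has 2^p > p letters, so the default value is never
    read. *)
Definition tm (p : nat) : bool := nth false (T p.+1) p.

Lemma nth_T (i p : nat) : p < 2 ^ i -> nth false (T i.+1) p = tm p.
Proof.
have stable m d : p < 2 ^ m ->
    nth false (T (d + m).+1) p = nth false (T m.+1) p.
  move=> pm; elim: d => // d IHd.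
  rewrite addSn TS nth_cat size_T IHd.
  by rewrite (leq_trans pm) // leq_exp2l // leq_addl.
(* [T i.+1] and [T p.+1] are compared through [T (p + i).+1], which extends both. *)
move=> pi; rewrite /tm -(stable i p pi) addnC stable //.
exact: ltn_expl.
Qed.

Lemma tm_double (p : nat) : tm p.*2 = tm p /\ tm p.*2.+1 = ~~ tm p.
Proof.
have pp : p < 2 ^ p by exact: ltn_expl.
have [e o] := @nth_morse (T p.+1) p (etrans (congr1 _ (size_T p)) pp).
have pp2 : p.*2.+1 < 2 ^ p.+1 by rewrite expnS; lia.
by rewrite -(nth_T p.+1 p.*2 (ltnW pp2)) -(nth_T p.+1 p.*2.+1 pp2) T_morse e o.
Qed.

Lemma tm2 (p : nat) : tm p.*2 = tm p. Proof. exact: (tm_double p).1. Qed.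

Lemma tm2S (p : nat) : tm p.*2.+1 = ~~ tm p. Proof. exact: (tm_double p).2. Qed.

(** * Occurrences letter by letter, at positions counted from 0 *)

Lemma occP (P S : word) (x : nat) :
  occ P S x <-> exists p, [/\ x = p.+1, p + size P <= size S
    & forall q, q < size P -> nth false S (p + q) = nth false P q].
Proof.
split=> [[u [v [-> ->]]]|[p [-> le_pS eqS]]].
  exists (size u); split=> [//||q qP].
    by rewrite !size_cat; lia.
  by rewrite nth_cat ltnNge leq_addr /= addKn nth_cat qP.
exists (take p S), (drop (size P) (drop p S)); split; last first.
  by rewrite size_take_min; congr _.+1; lia.
rewrite -[LHS](cat_take_drop p); congr (_ ++ _).
rewrite -[LHS](cat_take_drop (size P)); congr (_ ++ _).
apply: (@eq_from_nth _ false); first by rewrite size_take_min size_drop; lia.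
move=> q; rewrite size_take_min size_drop => ltq.
by rewrite nth_take ?nth_drop ?eqS; lia.
Qed.

(* Occurrence at the 0-based position p of T_(n+1) of the word T_(k+1)
   (c = false) or of its complement (c = true). *)
Definition occ0 (c : bool) (k n p : nat) : Prop :=
  p + 2 ^ k <= 2 ^ n /\ forall q, q < 2 ^ k -> tm (p + q) = c (+) tm q.

Lemma occ_occ0 (c : bool) (k n x : nat) :
  occ (if c then overline (T k.+1) else T k.+1) (T n.+1) x <->
  exists p, x = p.+1 /\ occ0 c k n p.
Proof.
set P := if c then _ else _.
have sP : size P = 2 ^ k by rewrite /P; case: c {P}; rewrite ?size_map size_T.
have nP q : q < 2 ^ k -> nth false P q = c (+) tm q.
  move=> qk; rewrite /P; case: c {P sP}; last by rewrite nth_T.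
  by rewrite (nth_map false) ?size_T // nth_T.
split=> [/occP[p [-> le_p eqp]]|[p [-> [le_p eqp]]]].
  move: le_p; rewrite sP size_T => le_p.
  exists p; split=> //; split=> // q qk.
  by rewrite -nP // -eqp ?sP // nth_T //; lia.
apply/occP; exists p; rewrite sP size_T; split=> // q qk.
by rewrite nP // nth_T ?eqp //; lia.
Qed.

(** * Halving positions down to the factors ab and ba *)

Lemma occ0_1 (c : bool) (n p : nat) :
  occ0 c 1 n p <-> [/\ p + 2 <= 2 ^ n, tm p = c & tm p.+1 = ~~ c].
Proof.
split=> [[le_p eqp]|[le_p p0 p1]].
  split=> //; first by rewrite -[p]addn0 eqp // addbF.
  by rewrite -addn1 eqp // addbT.
split=> // -[|[|//]] _; first by rewrite addn0 p0 addbF.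
by rewrite addn1 p1 addbT.
Qed.

Lemma occ0_double (c : bool) (k n q : nat) :
  occ0 c k.+1 n.+1 q.*2 <-> occ0 c k n q.
Proof.
rewrite /occ0 !expnS; split=> -[le_q eqq]; split; try lia.
  move=> r rk; have := eqq r.*2; rewrite -doubleD !tm2; apply; lia.
move=> r rk; have eq2 : tm (q + r./2) = c (+) tm r./2 by apply: eqq; lia.
rewrite -[r]odd_double_half; case: (odd r); rewrite ?add1n ?add0n.
  by rewrite addnS -doubleD !tm2S eq2 addbN.
by rewrite -doubleD !tm2.
Qed.

Lemma occ0_even (c : bool) (k n p : nat) : occ0 c k.+2 n p -> ~~ odd p.
Proof.
move=> [_ eqp]; apply/negP => op.
have k4 : 2 ^ 2 <= 2 ^ k.+2 by rewrite leq_exp2l.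
(* For odd p, positions p+1 and p+2 carry the image of one letter, so they differ; in abba and baab
   the two middle letters agree. *)
have := eqp 1 (ltnW (ltnW k4)); have := eqp 2 (ltnW k4).
have -> : p + 1 = (p./2.+1).*2 by lia.
have -> : p + 2 = (p./2.+1).*2.+1 by lia.
by rewrite tm2 tm2S => e2 e1; move: e2; rewrite e1 /tm; case: c {eqp e1}.
Qed.

Lemma occ0_scale (c : bool) (k n p : nat) :
  occ0 c k.+1 (n + k) p <-> exists r, p = 2 ^ k * r /\ occ0 c 1 n r.
Proof.
elim: k p => [|k IHk] p.
  rewrite addn0; split=> [Hp|[r [-> ?]]]; last by rewrite mul1n.
  by exists p; rewrite mul1n.
rewrite addnS; split=> [Hp|[r [-> Hr]]].
  have dp : p = p./2.*2 by move: (occ0_even _ _ _ _ Hp); lia.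
  move: Hp; rewrite dp occ0_double => /IHk[r [-> Hr]].
  by exists r; split=> //; rewrite expnS; lia.
have -> : 2 ^ k.+1 * r = (2 ^ k * r).*2 by rewrite expnS; lia.
by apply/occ0_double/IHk; exists r.
Qed.

(** * Repeated letters, and pairs at odd positions *)

Lemma tm_repeat (c : bool) (q : nat) : tm q = c -> tm q.+1 = c ->
  exists s, [/\ q = s.*2.+1, tm s = ~~ c & tm s.+1 = c].
Proof.
move=> q0 q1; have [oq|eq] := boolP (odd q).
  have dq : q = q./2.*2.+1 by lia.
  exists q./2; split=> //.
    by rewrite -q0 {2}dq tm2S negbK.
  by rewrite -q1 {2}dq -doubleS tm2.
(* An even q would start the image of a letter, whose two letters differ. *)
have dq : q = q./2.*2 by lia.
by move: q1; rewrite dq tm2S -tm2 -dq q0; case: c {q0}.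
Qed.

(** An ab at an odd position straddles two images ba, hence comes from a factor bb at q, which
    [tm_repeat] locates. *)
Lemma occ0_1_odd (c : bool) (n q : nat) : occ0 c 1 n.+2 q.*2.+1 <->
  exists s, q = s.*2.+1 /\ occ0 c 1 n s.
Proof.
rewrite occ0_1 tm2S -doubleS tm2 !expnS; split=> [[le_q q0 q1]|[s [-> ]]].
  have [|s [dq s0 s1]] := @tm_repeat (~~ c) q _ q1; first by rewrite -q0 negbK.
  exists s; split=> //; apply/occ0_1; split=> //; last by rewrite s0 negbK.
  (* The bound 4s + 5 <= 4 * 2^n gives s + 2 <= 2^n by divisibility by 4. *)
  by lia.
move=> /occ0_1[le_s s0 s1]; rewrite -doubleS tm2 tm2S s0 s1 negbK.
by split=> //; lia.
Qed.

(** A letter is the first or the second one of the image containing it, and that image fits because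
    [2 ^ n.+1] is even. *)
Lemma occ0_0 (c : bool) (n p : nat) : occ0 c 0 n.+1 p <->
  occ0 c 1 n.+1 p \/ exists r, p = r.+1 /\ occ0 (~~ c) 1 n.+1 r.
Proof.
have occ0_0E : occ0 c 0 n.+1 p <-> p < 2 ^ n.+1 /\ tm p = c.
  rewrite /occ0 addn1; split=> -[le_p]; last first.
    by move=> p0; split=> // -[|//] _; rewrite addn0 p0 addbF.
  by move=> /(_ 0); rewrite addn0 addbF => ->.
rewrite occ0_0E; split=> [[le_p p0]|]; last first.
  move=> [/occ0_1[le_p p0 _]|[r [-> /occ0_1[le_r _]]]].
    by split=> //; lia.
  by rewrite negbK => r1; split=> //; lia.
move: le_p; rewrite expnS => le_p.
have [op|ep] := boolP (odd p).
  have dp : p = p./2.*2.+1 by lia.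
  right; exists p./2.*2; split=> //; apply/occ0_1; split.
  - by rewrite expnS; lia.
  - by rewrite -p0 {2}dp tm2 tm2S negbK.
  - by rewrite -dp negbK.
have dp : p = p./2.*2 by lia.
left; apply/occ0_1; split=> //; first by rewrite expnS; lia.
by rewrite dp tm2S -tm2 -dp p0.
Qed.

(** For k > 0, p = 2^(k-1) r with a pair at r. If r is even, a single letter at r/2 remains, and
    [occ0_0] gives the first two cases. If r is odd, [occ0_1_odd] gives r = 4s + 3, whence the shift
    2^k + 2^(k-1). *)
Lemma occ0_split (c : bool) (k m p : nat) : occ0 c k (m.+2 + k) p <->
  [\/ occ0 c k.+1 (m.+2 + k) p,
      exists r, p = r + 2 ^ k /\ occ0 (~~ c) k.+1 (m.+2 + k) r
    | 0 < k /\ exists r, p = r + (2 ^ k + 2 ^ k.-1) /\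
                         occ0 c k.+2 (m.+2 + k) r].
Proof.
case: k => [|k].
  rewrite addn0 occ0_0; split=> [[?|[r [-> ?]]]|[?|[r [-> ?]]|[]//]].
  - exact: Or31.
  - by apply: Or32; exists r; rewrite addn1.
  - by left.
  - by right; exists r; rewrite addn1.
rewrite addnS -addSn; split.
  move=> /occ0_scale[r [-> Hr]]; have [odr|er] := boolP (odd r).
    have dr : r = r./2.*2.+1 by lia.
    move: Hr; rewrite dr => /occ0_1_odd[s [ds Hs]].
    apply: Or33; split=> //; exists (2 ^ k.+2 * s); split.
      by rewrite ds !expnS /=; lia.
    rewrite 2!addSnnS; apply/occ0_scale; by exists s.
  have dr : r = r./2.*2 by lia.
  move: Hr; rewrite dr => /occ0_double/occ0_0[Hs|[s [-> Hs]]].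
    apply: Or31; rewrite addSnnS; apply/occ0_scale.
    by exists r./2; split=> //; rewrite expnS; lia.
  apply: Or32; exists (2 ^ k.+1 * s); split; first by rewrite expnS; lia.
  by rewrite addSnnS; apply/occ0_scale; exists s.
move=> [||[_]].
- move=> Hp; apply/occ0_scale; move: Hp.
  rewrite addSnnS => /occ0_scale[r [-> Hr]].
  exists r.*2; split; first by rewrite expnS; lia.
  by apply/occ0_double/occ0_0; left.
- move=> [q [-> Hq]]; apply/occ0_scale; move: Hq.
  rewrite addSnnS => /occ0_scale[r [-> Hr]].
  exists r.+1.*2; split; first by rewrite expnS; lia.
  by apply/occ0_double/occ0_0; right; exists r.
- move=> [q [-> Hq]]; apply/occ0_scale; move: Hq.
  rewrite 2!addSnnS => /occ0_scale[r [-> Hr]].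
  exists (r.*2.+1).*2.+1; split; first by rewrite !expnS /=; lia.
  by apply/occ0_1_odd; exists r.
Qed.

(** One of y and y+1 is odd, and [occ0_1_odd] describes the pair there; the pair at the even
    position then follows. *)
Lemma occ0_1_succ (c : bool) (n y : nat) :
  occ0 c 1 n.+2 y.+1 /\ occ0 (~~ c) 1 n.+2 y <->
  exists s, y = s.*2.*2.+2 /\ occ0 c 1 n s \/
            y = s.*2.*2.+3 /\ occ0 (~~ c) 1 n s.
Proof.
split=> [[Hy1 Hy]|[s []]].
- have [oy|ey] := boolP (odd y).
    have dy : y = y./2.*2.+1 by lia.
    move: Hy; rewrite dy => /occ0_1_odd[s [ds Hs]].
    by exists s; right; rewrite ds doubleS.
  have dy : y = y./2.*2 by lia.
  move: Hy1; rewrite dy => /occ0_1_odd[s [ds Hs]].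
  by exists s; left; rewrite ds doubleS.
- have <- : s.*2.+1.*2 = s.*2.*2.+2 by rewrite doubleS.
  move=> [-> Hs]; split; first by apply/occ0_1_odd; exists s.
  case/occ0_1: Hs => le_s s0 _; apply/occ0_1.
  by rewrite tm2S tm2 tm2S s0 !expnS; split=> //; lia.
have <- : s.*2.+1.*2.+1 = s.*2.*2.+3 by rewrite doubleS.
move=> [-> Hs]; split; last by apply/occ0_1_odd; exists s.
case/occ0_1: Hs => le_s _ s1; apply/occ0_1.
by rewrite -!doubleS tm2S !tm2 s1 negbK !expnS; split=> //; lia.
Qed.

(** This is [occ0_1_succ] scaled by 2^k: the values 4s + 2 and 4s + 3 of y make y+1 equal to 4s + 3
    and 4s + 4, whence the two shifts. *)
Lemma occ0_split_cap (c : bool) (k m r : nat) :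
  occ0 c k.+1 (m.+2 + k) (r + 2 ^ k) /\ occ0 (~~ c) k.+1 (m.+2 + k) r <->
  (exists s, r + 2 ^ k = s + (2 ^ k.+1 + 2 ^ k) /\ occ0 c k.+3 (m.+2 + k) s) \/
  (exists s, r + 2 ^ k = s + 2 ^ k.+2 /\ occ0 (~~ c) k.+3 (m.+2 + k) s).
Proof.
have scale3 d s : occ0 d k.+3 (m.+2 + k) s <->
    exists r, s = 2 ^ k.+2 * r /\ occ0 d 1 m r.
  by rewrite !addSnnS; exact: occ0_scale.
have k0 : 0 < 2 ^ k by rewrite expn_gt0.
split=> [[/occ0_scale[x [dx Hx]] /occ0_scale[y [dy Hy]]]|].
  have {}dx : x = y.+1 by nia.
  rewrite {x}dx in Hx.
  have [s [[ds Hs]|[ds Hs]]] := (occ0_1_succ _ _ _).1 (conj Hx Hy);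
    [left|right].
    exists (2 ^ k.+2 * s); split; first by rewrite dy ds !expnS; lia.
    by apply/scale3; exists s.
  exists (2 ^ k.+2 * s); split; first by rewrite dy ds !expnS; lia.
  by apply/scale3; exists s.
have unscale y : occ0 c 1 m.+2 y.+1 /\ occ0 (~~ c) 1 m.+2 y -> r = 2 ^ k * y ->
    occ0 c k.+1 (m.+2 + k) (r + 2 ^ k) /\ occ0 (~~ c) k.+1 (m.+2 + k) r.
  move=> [Hy1 Hy] ->; split; apply/occ0_scale; last by exists y.
  by exists y.+1; rewrite mulnS addnC.
move=> [] [s [dr /scale3[z [dz Hz]]]]; move: dr; rewrite {s}dz !expnS => dr.
  apply: (unscale z.*2.*2.+2); last by lia.
  by apply/occ0_1_succ; exists z; left.
apply: (unscale z.*2.*2.+3); last by lia.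
by apply/occ0_1_succ; exists z; right.
Qed.

(** * Disjointness by powers of two *)

Lemma dvdn_occ0 (c : bool) (k n p : nat) : k <= n ->
  occ0 c k.+1 n p -> 2 ^ k %| p.
Proof.
by move=> /subnK <- /occ0_scale[r [-> _]]; exact: dvdn_mulr.
Qed.

(** Since p is a multiple of 2^(k+2), the shifted position is 2^k modulo 2^(k+1). Both disjointness
    claims rest on this. *)
Lemma occ0_shift_disj (c : bool) (k n p : nat) : k.+2 <= n ->
  occ0 c k.+3 n p -> 2 ^ k.+1 %| p + (2 ^ k.+1 + 2 ^ k) -> False.
Proof.
move=> kn /(dvdn_occ0 _ _ _ _ kn) /dvdnP[u ->].
have -> : u * 2 ^ k.+2 + (2 ^ k.+1 + 2 ^ k) = (u.*2.+1) * 2 ^ k.+1 + 2 ^ k.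
  by rewrite !expnS; lia.
rewrite dvdn_addr ?dvdn_mull // => /dvdn_leq.
by rewrite expn_gt0 leq_exp2l // ltnn => /(_ isT).
Qed.

(** * Back to the sets of positions counted from 1 *)

Lemma AE (n j x : nat) : j <= n ->
  A n.+1 j x <-> exists p, x = p.+1 /\ occ0 false (n - j) n p.
Proof. by move=> jn; rewrite /A subSn //; exact: (occ_occ0 false). Qed.

Lemma BE (n j x : nat) : j <= n ->
  B n.+1 j x <-> exists p, x = p.+1 /\ occ0 true (n - j) n p.
Proof. by move=> jn; rewrite /B subSn //; exact: (occ_occ0 true). Qed.

Lemma oplusE (X : set nat) (P : nat -> Prop) (d x : nat) :
  (forall y, X y <-> exists p, y = p.+1 /\ P p) ->
  oplus X d x <-> exists p, x = p.+1 /\ exists r, p = r + d /\ P r.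
Proof.
move=> XE; split=> [[y /XE[r [-> Pr]] <-]|[p [-> [r [-> Pr]]]]].
  by exists (r + d); split=> //; exists r.
by exists r.+1 => //; apply/XE; exists r.
Qed.

Lemma occ0_full (n p : nat) : occ0 false n n p -> p = 0.
Proof. by case; lia. Qed.

Lemma occ0_half (n p : nat) : occ0 false n n.+1 p -> p = 0.
Proof.
case: n => [[le_p /(_ 0 isT)]|n].
  by rewrite addn1 in le_p; rewrite addn0 /tm; case: p le_p => [|[|p]].
(* After scaling, ab is sought in abba, where it occurs only at 0. *)
rewrite -[n.+2]/(2 + n) => /occ0_scale[r [-> /occ0_1[]]].
by rewrite addn2; case: r => [|[|[|r]]]; rewrite /tm ?muln0.
Qed.

Theorem theorem18 : forall i : nat, 2 <= i ->
  [/\ A i 0 = [set 1],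
      A i 1 = [set 1]
    & forall j : nat, 2 <= j -> j <= i - 1 ->
      [/\ A i j = A i (j - 1) `|` B'_m1 i j `|` A'_m2 i j,
          A i (j - 1) `&` B'_m1 i j = I_m3 i j,
          A i (j - 1) `&` A'_m2 i j = set0
        & B'_m1 i j `&` A'_m2 i j = set0]].
Proof.
case=> [//|[//|n]] _; split.
- apply/seteqP; split=> x.
    by move=> /AE[//|p [->]]; rewrite subn0 => /occ0_full ->.
  by move=> ->; apply/AE => //; exists 0; rewrite subn0; split=> //; split.
- apply/seteqP; split=> x.
    by move=> /AE[//|p [->]]; rewrite subn1 => /occ0_half ->.
  move=> ->; apply/AE => //; exists 0; rewrite subn1; split=> //; split=> //.
  by rewrite leq_exp2l.
move=> [|[|m]] // _; rewrite subn1 /= => mn.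
(* With k = i - j - 1, the word T_(i-j) is [T k.+1] and tau_(i-j) = 2^k. *)
have [k dn] : exists k, n.+1 = m.+2 + k by exists (n.+1 - m.+2); lia.
rewrite dn.
have A0 x : A (m.+2 + k).+1 m.+2 x <->
    exists p, x = p.+1 /\ occ0 false k (m.+2 + k) p.
  by rewrite AE ?leq_addr // addKn.
have A1 x : A (m.+2 + k).+1 (m.+2 - 1) x <->
    exists p, x = p.+1 /\ occ0 false k.+1 (m.+2 + k) p.
  by rewrite AE; [have -> : m.+2 + k - (m.+2 - 1) = k.+1 by lia|lia].
have B1 x : B'_m1 (m.+2 + k).+1 m.+2 x <->
    exists p, x = p.+1 /\
      exists r, p = r + 2 ^ k /\ occ0 true k.+1 (m.+2 + k) r.
  rewrite /B'_m1 tauE; last by lia.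
  have -> : ((m.+2 + k).+1 - m.+2).-1 = k by lia.
  apply: oplusE => y.
  by rewrite BE; [have -> : m.+2 + k - (m.+2 - 1) = k.+1 by lia|lia].
have A2 x : A'_m2 (m.+2 + k).+1 m.+2 x <->
    exists p, x = p.+1 /\ (0 < k /\
      exists r, p = r + (2 ^ k + 2 ^ k.-1) /\ occ0 false k.+2 (m.+2 + k) r).
  (* The guard j + 1 < i is the side condition 0 < k of [occ0_split]. *)
  rewrite /A'_m2; have -> : (m.+2 + 1 < (m.+2 + k).+1) = (0 < k) by lia.
  case: ifP => [k0|_]; last by split=> // -[p [_ []]].
  rewrite !tauE; [|lia|lia].
  have -> : ((m.+2 + k).+1 - m.+2).-1 = k by lia.
  have -> : ((m.+2 + k).+1 - (m.+2 + 1)).-1 = k.-1 by lia.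
  rewrite (@oplusE _ (occ0 false k.+2 (m.+2 + k))); last first.
    move=> y.
    by rewrite AE; [have -> : m.+2 + k - (m.+2 - 2) = k.+2 by lia|lia].
  by split=> -[p [-> Hp]]; exists p; [|case: Hp].
have I3 x : I_m3 (m.+2 + k).+1 m.+2 x <-> exists p, x = p.+1 /\
    ((exists s, p = s + (2 ^ k.+1 + 2 ^ k) /\ occ0 false k.+3 (m.+2 + k) s) \/
     (exists s, p = s + 2 ^ k.+2 /\ occ0 true k.+3 (m.+2 + k) s)).
  rewrite /I_m3; case: eqP => [[->]|m2].
    split=> // -[p [_ H]].
    (* For j = 2 the word sought would be twice as long as T_i, so both alternatives are void. *)
    have long c s : ~ occ0 c k.+3 (2 + k) s.
      by case; have := expn_gt0 2 k; rewrite !addSn !expnS; lia.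
    by case: H => -[s [_ /long]].
  rewrite /A'_m3 /B'_m3 !tauE; [|lia|lia|lia].
  have -> : ((m.+2 + k).+1 - (m.+2 - 1)).-1 = k.+1 by lia.
  have -> : ((m.+2 + k).+1 - m.+2).-1 = k by lia.
  have -> : ((m.+2 + k).+1 - (m.+2 - 2)).-1 = k.+2 by lia.
  have d3 : m.+2 + k - (m.+2 - 3) = k.+3 by lia.
  have -> : forall X Y : set nat, (X `|` Y) x <-> X x \/ Y x by [].
  rewrite (@oplusE _ (occ0 false k.+3 (m.+2 + k))); last first.
    by move=> y; rewrite AE; [rewrite d3|lia].
  rewrite (@oplusE _ (occ0 true k.+3 (m.+2 + k))); last first.
    by move=> y; rewrite BE; [rewrite d3|lia].
  split=> [[[p [-> H]]|[p [-> H]]]|[p [-> [H|H]]]].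
  - by exists p; split=> //; left.
  - by exists p; split=> //; right.
  - by left; exists p.
  - by right; exists p.
split; apply/seteqP; split=> x.
- move=> /A0[p [-> /occ0_split[H|H|H]]].
  + by left; left; apply/A1; exists p.
  + by left; right; apply/B1; exists p.
  + by right; apply/A2; exists p.
- case=> [[/A1|/B1]|/A2] [p [-> H]]; apply/A0; exists p; split=> //.
  + by apply/occ0_split/Or31.
  + by apply/occ0_split/Or32.
  + by apply/occ0_split/Or33.
- move=> [/A1[p [-> Hp]] /B1[_ [[<-] [r [dr Hr]]]]].
  apply/I3; exists p; split=> //.
  by rewrite dr in Hp *; apply/occ0_split_cap.
- move=> /I3[p [-> H]].
  (* Both shifts are at least 2^k, so 2^k can be split off p as [occ0_split_cap] requires. *)
  have [r dr] : exists r, p = r + 2 ^ k.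
    case: H => -[s [-> _]]; first by exists (s + 2 ^ k.+1); rewrite addnA.
    by exists (s + 3 * 2 ^ k); rewrite !expnS; lia.
  move: H; rewrite dr => /(occ0_split_cap false)[H1 H2].
  by split; [apply/A1|apply/B1]; exists (r + 2 ^ k); split=> //; exists r.
- move=> [/A1[p [-> Hp]] /A2[_ [[<-] [k0 [r [dr Hr]]]]]].
  (* Since k > 0, it is replaced by its successor form to match [occ0_shift_disj]. *)
  case: k k0 dn {A0 A1 B1 A2 I3} Hp dr Hr => // k _ _ Hp dr Hr.
  apply: (@occ0_shift_disj _ _ _ _ _ Hr); first by lia.
  by rewrite -dr; apply: (@dvdn_occ0 _ _ _ _ _ Hp); lia.
- by [].
- move=> [/B1[p [-> [q [dq Hq]]]] /A2[_ [[<-] [k0 [r [dr Hr]]]]]].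
  case: k k0 dn {A0 A1 B1 A2 I3} dq Hq dr Hr => // k _ _ dq Hq dr Hr.
  apply: (@occ0_shift_disj _ _ _ _ _ Hr); first by lia.
  by rewrite -dr dq dvdn_addl //; apply: (@dvdn_occ0 _ _ _ _ _ Hq); lia.
- by [].
Qed.
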